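(* Let $K\subset\mathbb{R}^n$ be a nonempty compact convex set with set of extreme points $V$, and let $f:K\to\mathbb{R}$ be a bounded function such that $Sf=f$. Let $\phi:=f|_V$ and let $E_{K,\phi}$ be the extremal approximately convex function with extreme values $\phi$. Then $f=E_{K,\phi}$.
   Context: A function $h:K\to\mathbb{R}$ is approximately convex if $h\bigl(\frac{a+b}{2}\bigr)\le\frac{h(a)+h(b)}{2}+1$ for all $a,b\in K$. For a bounded function $h:K\to\mathbb{R}$, the function $Sh$ on $K$ is defined by $Sh(x)=h(x)$ if $x\in V$, and $$Sh(x)=\inf\Bigl\{\frac{h(y)+h(z)}{2}+1\ :\ y,z\in K,\ \frac{y+z}{2}=x\Bigr\}\quad\text{if } x\in K\setminus V.$$ For $\phi:V\to\mathbb{R}$, let $\mathcal{B}(K,\phi)$ be the set of bounded approximately convex functions $h:K\to\mathbb{R}$ with $h|_V\le\phi$ on $V$; the extremal approximately convex function with extreme values $\phi$ is $E_{K,\phi}(x)=\sup_{h\in\mathcal{B}(K,\phi)}h(x)$. *)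

(* Defs.v *)
From HB Require Import structures.
From mathcomp Require Import all_boot all_order all_algebra.
From mathcomp Require Import all_classical all_reals all_analysis.
Set Implicit Arguments.
Unset Strict Implicit.
Unset Printing Implicit Defensive.
Import Order.TTheory GRing.Theory Num.Theory.
Import numFieldNormedType.Exports.
Local Open Scope classical_set_scope.
Local Open Scope ring_scope.
Local Open Scope convex_scope.

(* A function K -> R is represented by a total function on 'rV[R]_n of which
   only the values on the convex set K matter; S_op and extremal are meant to
   be evaluated at points of K only. *)

Definition extreme_points (R : realType) (n : nat) (K : set 'rV[R]_n) :
    set 'rV[R]_n :=
  [set x | K x /\
     forall (y z : convex_lmodType 'rV[R]_n) (t : {i01 R}),
       K y -> K z -> 0 < t%:num < 1 -> y <| t |> z = x -> y = x /\ z = x].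

Definition approx_convex (R : realType) (n : nat) (K : set 'rV[R]_n)
    (h : 'rV[R]_n -> R) : Prop :=
  forall a b, K a -> K b -> h (2^-1 *: (a + b)) <= (h a + h b) / 2 + 1.

(* The real infimum is over a nonempty set when x \in K (take y = z = x),
   and that set is bounded below when h is bounded on K. *)
Definition S_op (R : realType) (n : nat) (K : set 'rV[R]_n)
    (h : 'rV[R]_n -> R) (x : 'rV[R]_n) : R :=
  if x \in extreme_points K then h x
  else inf [set r | exists y z, [/\ K y, K z, 2^-1 *: (y + z) = x
                                  & r = (h y + h z) / 2 + 1]].

Definition B_set (R : realType) (n : nat) (K : set 'rV[R]_n)
    (phi : 'rV[R]_n -> R) : set ('rV[R]_n -> R) :=
  [set h | [/\ [bounded h x | x in K], approx_convex K h
             & forall v, extreme_points K v -> h v <= phi v]].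

(* The supremum is taken in the extended reals, so that it is the true
   supremum even where the family is empty or unbounded above. *)
Definition extremal (R : realType) (n : nat) (K : set 'rV[R]_n)
    (phi : 'rV[R]_n -> R) (x : 'rV[R]_n) : \bar R :=
  ereal_sup [set (h x)%:E | h in B_set K phi].

(* Main.v *)
Require Import Defs.
From HB Require Import structures.
From mathcomp Require Import all_boot all_order all_algebra.
From mathcomp Require Import all_classical all_reals all_analysis.
From mathcomp Require Import lra.
Set Implicit Arguments.
Unset Strict Implicit.
Unset Printing Implicit Defensive.
Import Order.TTheory GRing.Theory Num.Theory.
Import numFieldNormedType.Exports.
Local Open Scope classical_set_scope.
Local Open Scope ring_scope.

(** A fixed point [f] of the operator [S] is approximately convex, and it
    agrees with [phi] on the extreme points, so it is a member of the family
    whose supremum is [extremal K phi]; this gives one inequality.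

    For the other one, let [h] be a member of the family, and suppose that
    [g = h - f] has a supremum [d > 0] on [K].  At a point [x] with [g x > 0],
    which is not extreme because [h <= phi = f] at the extreme points, the
    value [f x] is an infimum over the pairs [y, z] with midpoint [x].  A pair
    that almost attains it satisfies [(f y + f z) / 2 + 1 < f x + e]
    ([fixed_point_near_minimizer]), and approximate convexity of [h] gives
    [g x <= (g y + g z) / 2 + e].  If [g x] is close to [d], the second bound
    makes both [g y] and [g z] close to [d], while the first one makes
    [f y <= f x - 1/2] or [f z <= f x - 1/2].  So one of the two points is
    again a near-maximizer of [g], with [f] smaller by at least [1/2]
    ([bounded_gap_le0]).  Starting close enough to the supremum, this can be
    repeated any number of times, and [f] would not be bounded below. *)

Lemma bounded_on_norm_le (R : realType) (T : Type) (K : set T) (h : T -> R) :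
  [bounded h x | x in K] -> exists M : R, forall x, K x -> `|h x| <= M.
Proof. by move=> /(pinfty_ex_gt (real0 R))[M _ hM]; exists M. Qed.

Lemma midpoint_conv (R : realType) (n : nat) :
  exists2 t : {i01 R}, 0 < t%:num < 1 &
    forall a b : convex_lmodType 'rV[R]_n,
      conv t a b = 2^-1 *: ((a : 'rV[R]_n) + b).
Proof.
have h0 : 0 <= 2^-1 :> R by lra.
have h1 : 2^-1 <= 1 :> R by lra.
exists (Itv01 h0 h1) => [|a b] /=; first by apply/andP; split; lra.
rewrite /conv /= scalerDr; congr (_ + _ *: _); rewrite /unstable.onem; lra.
Qed.

Lemma convex_set_midpoint (R : realType) (n : nat) (K : set 'rV[R]_n)
    (a b : 'rV[R]_n) :
  convex_set (M := 'rV[R]_n) K -> K a -> K b -> K (2^-1 *: (a + b)).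
Proof.
move=> Kconv Ka Kb; have [t _ tE] := midpoint_conv R n.
by have := Kconv a b t; rewrite tE !inE => /(_ Ka Kb).
Qed.

Lemma extreme_midpoint (R : realType) (n : nat) (K : set 'rV[R]_n)
    (a b : 'rV[R]_n) :
  extreme_points K (2^-1 *: (a + b)) -> K a -> K b ->
  a = 2^-1 *: (a + b) /\ b = 2^-1 *: (a + b).
Proof.
move=> [_ ext] Ka Kb; have [t t01 tE] := midpoint_conv R n.
exact: (ext a b t).
Qed.

Lemma S_op_nonextreme (R : realType) (n : nat) (K : set 'rV[R]_n)
    (f : 'rV[R]_n -> R) (x : 'rV[R]_n) :
  ~ extreme_points K x ->
  S_op K f x = inf [set r | exists y z, [/\ K y, K z, 2^-1 *: (y + z) = x
                                          & r = (f y + f z) / 2 + 1]].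
Proof. by move=> xV; rewrite /S_op; case: ifP => //; rewrite inE. Qed.

Lemma fixed_point_approx_convex (R : realType) (n : nat) (K : set 'rV[R]_n)
    (f : 'rV[R]_n -> R) :
  [bounded f x | x in K] -> (forall x, K x -> S_op K f x = f x) ->
  convex_set (M := 'rV[R]_n) K -> approx_convex K f.
Proof.
move=> f_bounded Sf Kconv a b Ka Kb.
have [ext|next] := pselect (extreme_points K (2^-1 *: (a + b))).
  have [ea eb] := extreme_midpoint ext Ka Kb.
  by rewrite {2}ea {3}eb; lra.
have [M fM] := bounded_on_norm_le f_bounded.
rewrite -(Sf _ (convex_set_midpoint Kconv Ka Kb)) (S_op_nonextreme f next).
apply: ge_inf; last by exists a, b.
exists (1 - M) => _ [y [z [Ky Kz _ ->]]].
have := fM y Ky; have := fM z Kz; rewrite !ler_norml => /andP[? _] /andP[? _].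
lra.
Qed.

Lemma fixed_point_near_minimizer (R : realType) (n : nat) (K : set 'rV[R]_n)
    (f : 'rV[R]_n -> R) (x : 'rV[R]_n) (e : R) :
  [bounded f x | x in K] -> (forall x, K x -> S_op K f x = f x) ->
  K x -> ~ extreme_points K x -> 0 < e ->
  exists y z, [/\ K y, K z, 2^-1 *: (y + z) = x
                & (f y + f z) / 2 + 1 < f x + e].
Proof.
move=> f_bounded Sf Kx next e0.
have [M fM] := bounded_on_norm_le f_bounded.
have := Sf x Kx; rewrite (S_op_nonextreme f next) => <-.
set A := [set r | _].
have Ainf : has_inf A.
  split.
    exists ((f x + f x) / 2 + 1), x, x; split=> //.
    by rewrite -mulr2n -[x *+ 2]scaler_nat scalerA mulVf ?scale1r // pnatr_eq0.
  exists (1 - M) => _ [y [z [Ky Kz _ ->]]].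
  have := fM y Ky; have := fM z Kz; rewrite !ler_norml => /andP[? _] /andP[? _].
  lra.
have [_ [y [z [Ky Kz yz ->]]] lt] := inf_adherent e0 Ainf.
by exists y, z.
Qed.

(** The descent argument: near-maximizers of [g] reproduce themselves with [f]
    decreased by [1/2] each time, which a lower bound on [f] forbids if the
    supremum of [g] is positive. *)
Lemma bounded_gap_le0 (R : realType) (T : Type) (K : set T) (f g : T -> R)
    (C M : R) :
  (forall x, K x -> `|f x| <= C) -> (forall x, K x -> g x <= M) ->
  (forall x e, K x -> 0 < g x -> 0 < e ->
     exists y z, [/\ K y, K z, (f y + f z) / 2 + 1 < f x + e
                   & g x <= (g y + g z) / 2 + e]) ->
  forall x, K x -> g x <= 0.
Proof.
move=> fC gM step x0 Kx0; rewrite leNgt; apply/negP => gx0.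
have supg : has_sup [set g x | x in K].
  by split; [exists (g x0), x0 | exists M => _ [x Kx <-]; exact: gM].
set d := sup [set g x | x in K].
have gd x : K x -> g x <= d.
  by move=> Kx; apply: sup_upper_bound => //; exists x.
have d0 : 0 < d := lt_le_trans gx0 (gd _ Kx0).
(* Quantified over every precision [e], because each step spends some of it. *)
have descent (k : nat) : forall e : R, 0 < e ->
    exists x, [/\ K x, d - e < g x & f x <= C - k%:R / 2].
  elim: k => [|k IH] e e0.
    have [_ [x Kx <-] xd] := sup_adherent e0 supg.
    exists x; split=> //; rewrite mul0r subr0.
    exact: le_trans (ler_norm _) (fC _ Kx).
  (* A gap of at most [d] keeps [g x] positive; a gap of [e / 4] here and a
     slack of [e / 4] in the step add up to [2 * (e / 4 + e / 4) = e]. *)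
  have r0 : 0 < Num.min d (e / 4) by rewrite lt_min d0 divr_gt0.
  have [x [Kx xd fx]] := IH _ r0.
  have [rd re] : Num.min d (e / 4) <= d /\ Num.min d (e / 4) <= e / 4.
    by rewrite !ge_min !lexx orbT.
  have gx : 0 < g x by lra.
  have s0 : 0 < Num.min 2^-1 (e / 4) by rewrite lt_min !divr_gt0 ?invr_gt0 ?ltr0n.
  have [sh se] : Num.min 2^-1 (e / 4) <= 2^-1 /\ Num.min 2^-1 (e / 4) <= e / 4.
    by rewrite !ge_min !lexx orbT.
  have [y [z [Ky Kz fyz gyz]]] := step x _ Kx gx s0.
  have gy := gd y Ky; have gz := gd z Kz.
  rewrite -natr1.
  by have [yz|/ltW zy] := leP (f y) (f z); [exists y | exists z]; split=> //; lra.
have [x [Kx _ fx]] := descent (Num.truncn (4 * C)).+1 d d0.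
have := truncnS_gt (4 * C); have := fC x Kx; rewrite ler_norml => /andP[? _].
lra.
Qed.

Theorem theorem2p10 (R : realType) (n : nat) (K : set 'rV[R]_n)
    (K_nonempty : K !=set0) (K_compact : compact K)
    (K_convex : convex_set (M := 'rV[R]_n) K)
    (f : 'rV[R]_n -> R)
    (f_bounded : [bounded f x | x in K])
    (Sf : forall x, K x -> S_op K f x = f x)
    (phi : 'rV[R]_n -> R)
    (phi_f : forall v, extreme_points K v -> phi v = f v) :
  forall x, K x -> (f x)%:E = extremal K phi x.
Proof.
move=> x Kx; apply/eqP; rewrite eq_le; apply/andP; split.
  apply: ereal_sup_ubound; exists f => //; split=> //.
  - exact: fixed_point_approx_convex.
  - by move=> v /phi_f ->.
apply: ge_ereal_sup => _ [h [h_bounded h_convex h_phi] <-].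
rewrite lee_fin -subr_le0.
have [Cf fC] := bounded_on_norm_le f_bounded.
have [Ch hC] := bounded_on_norm_le h_bounded.
apply: (@bounded_gap_le0 R _ K f (fun y => h y - f y) Cf (Ch + Cf)) => //.
  move=> y Ky; have := fC y Ky; have := hC y Ky.
  by rewrite !ler_norml => /andP[_ ?] /andP[? _]; lra.
move=> w e Kw gw e0.
have next : ~ extreme_points K w.
  by move=> wV; have := h_phi w wV; rewrite phi_f //; lra.
have [y [z [Ky Kz yz fyz]]] := fixed_point_near_minimizer f_bounded Sf Kw next e0.
have := h_convex y z Ky Kz; rewrite yz => hw.
by exists y, z; split=> //; lra.
Qed.
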